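(* Let $x=(X,f)$ be a point in $\mathcal{T}_{g,m}$ and let $\omega$ be a real $1$-form on $\mathcal{T}_{g,m}$. Suppose that $\omega$ is represented by $\psi\in A^2(X)\cong T_x^*\mathcal{T}_{g,m}$ at $x$ and that $\|\omega\|_T(x)=\|\psi\|_1<1$. Then, for every $\varphi\in A^2(X)$, $$G_\omega(\varphi)=\inf\left\{t>0 \;:\; \left\|\frac{\varphi}{t}-\psi\right\|_1\le 1\right\}.$$ In particular, if $\varphi\neq0$, then $$\left\|\frac{\varphi}{G_\omega(\varphi)}-\psi\right\|_1=1.$$
   Context: $\mathcal{T}_{g,m}$ is the Teichmüller space of a closed orientable surface $\Sigma_{g,m}$ of genus $g$ with $m$ points deleted ($m\ge4$ if $g=0$, $m\ge1$ if $g=1$); its points are classes $x=(X,f)$ of marked analytically finite Riemann surfaces $f:\Sigma_{g,m}\to X$ of type $(g,m)$. $L^\infty(X)$ is the space of bounded measurable $(-1,1)$-forms (Beltrami differentials) on $X$; $A^2(X)$ is the space of holomorphic quadratic differentials $\varphi$ on $X$ with $\|\varphi\|_1=\int_X|\varphi|\,dxdy<\infty$; $N^\infty(X)=\{\mu\in L^\infty(X):\int_X\mu\varphi=0\ \forall\varphi\in A^2(X)\}$. The tangent space is $T_x\mathcal{T}_{g,m}=L^\infty(X)/N^\infty(X)$, and the pairing $\langle v,\varphi\rangle=\int_X\mu\varphi$ ($v=[\mu]$) identifies $A^2(X)$ with the cotangent space $T_x^*\mathcal{T}_{g,m}$. A real $1$-form $\omega$ is represented by $\psi\in A^2(X)$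 at $x$ if $\omega(v)=\mathrm{Re}\langle v,\psi\rangle$ for all $v\in T_x\mathcal{T}_{g,m}$. The Teichmüller metric is $\kappa(x;v)=\sup\{\mathrm{Re}\langle v,\varphi\rangle:\varphi\in A^2(X),\ \|\varphi\|_1=1\}$, and $\|\omega\|_T(x)=\sup\{\omega(v): v\in T_x\mathcal{T}_{g,m},\ \kappa(x;v)\le1\}$. The Teichmüller--Randers metric associated with $\omega$ is $\kappa^\omega(x;v)=\kappa(x;v)+\omega(v)$. The Teichmüller--Randers cometric at $x$ is the function on $A^2(X)$ $$G_\omega(\varphi)=\sup\{\mathrm{Re}\langle v,\varphi\rangle : v\in T_x\mathcal{T}_{g,m},\ \kappa^\omega(x;v)=1\}.$$ *)

(* Defs.v *)
From HB Require Import structures.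
From mathcomp Require Import all_boot all_order all_algebra.
From mathcomp Require Import complex.
From mathcomp Require Import all_classical all_reals all_analysis.

Set Implicit Arguments.
Unset Strict Implicit.
Unset Printing Implicit Defensive.

Import Order.TTheory GRing.Theory Num.Theory numFieldNormedType.Exports.
Local Open Scope classical_set_scope.
Local Open Scope ring_scope.
Local Open Scope complex_scope.

(* R[i], seen as a numFieldType: this view carries the topology and the notion
   of complex derivative. *)
Definition complex_field (R : realType) : numFieldType :=
  Eval cbv beta delta [reverse_coercion] in R[i].
Notation Cplx R := (Num.NumField.sort (complex_field R)).

Definition homeo_on (S T : topologicalType) (A : set S) (B : set T)
    (f : S -> T) (g : T -> S) : Prop :=
  [/\ forall x, A x -> B (f x) /\ g (f x) = x,
      forall y, B y -> A (g y) /\ f (g y) = y,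
      {within A, continuous f} & {within B, continuous g}].

Definition homeomorphic (S T : topologicalType) (A : set S) (B : set T) : Prop :=
  exists f g, homeo_on A B f g.

Definition homotopic_on (R : realType) (S T : topologicalType) (A : set S)
    (f g : S -> T) : Prop :=
  exists H : R * S -> T,
    [/\ {within `[0, 1] `*` A, continuous H},
        forall x, A x -> H (0, x) = f x & forall x, A x -> H (1, x) = g x].

(* The chart [chart i] is a homeomorphism of the open set [dom i] onto the open
   set [img i] of the complex plane, with inverse [param i]; the values of the
   two maps outside these sets are irrelevant.  A Riemann surface is second
   countable, hence it has a countable atlas. *)
Record riemann_surface (R : realType) := RiemannSurface {
  carrier :> topologicalType ;
  dom : nat -> set carrier ;
  img : nat -> set (Cplx R) ;
  chart : nat -> carrier -> Cplx R ;
  param : nat -> Cplx R -> carrier ;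
  carrier_hausdorff : hausdorff_space carrier ;
  carrier_connected : connected [set: carrier] ;
  dom_open : forall i, open (dom i) ;
  img_open : forall i, open (img i) ;
  dom_cover : forall p, exists i, dom i p ;
  chart_homeo : forall i, homeo_on (dom i) (img i) (chart i) (param i) ;
  transition_holo : forall i j z, img i z -> dom j (param i z) ->
    derivable (chart j \o param i : Cplx R -> Cplx R) z 1
}.

Arguments dom {R} X i _ : rename.
Arguments img {R} X i _ : rename.
Arguments chart {R} X i _ : rename.
Arguments param {R} X i _ : rename.

(* The expression of h : X -> Y in the charts i of X and j of Y, defined at the
   points z of [img X i] such that h (param X i z) is in [dom Y j]. *)
Definition in_charts (R : realType) (X Y : riemann_surface R) (h : X -> Y)
    (i j : nat) (z : Cplx R) : Cplx R :=
  chart Y j (h (param X i z)).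

Definition holomorphic_map (R : realType) (X Y : riemann_surface R)
    (h : X -> Y) : Prop :=
  continuous h /\
  forall i j z, img X i z -> dom Y j (h (param X i z)) ->
    derivable (in_charts h i j) z 1.

Definition biholomorphism (R : realType) (X Y : riemann_surface R)
    (h : X -> Y) : Prop :=
  holomorphic_map h /\
  exists k : Y -> X, [/\ holomorphic_map k, cancel h k & cancel k h].

(* The set handle_poly g x y >= 0 is the closed disc of radius 3g+2 around the
   origin minus the g disjoint open unit discs around (3,0), (6,0), ..., (3g,0).
   The equation z^2 = handle_poly g x y thus defines the double of a disc with g
   holes, a closed orientable surface of genus g smoothly embedded in R^3. *)
Definition outer_radius (R : realType) (g : nat) : R := (3 * g + 2)%:R.

Definition handle_poly (R : realType) (g : nat) (x y : R) : R :=
  (outer_radius R g ^+ 2 - x ^+ 2 - y ^+ 2) *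
  \prod_(k < g) ((x - (3 * k.+1)%:R) ^+ 2 + y ^+ 2 - 1).

Definition closed_surface (R : realType) (g : nat) : set (R * R * R) :=
  [set p | p.2 ^+ 2 = handle_poly g p.1.1 p.1.2].

Arguments closed_surface : clear implicits.

(* Pairwise distinct points of the circle z = 0, x^2 + y^2 = (3g+2)^2, which
   lies on [closed_surface R g]. *)
Definition puncture (R : realType) (g k : nat) : R * R * R :=
  (outer_radius R g * ((1 - k%:R ^+ 2) / (1 + k%:R ^+ 2)),
   outer_radius R g * ((2 * k%:R) / (1 + k%:R ^+ 2)), 0).

Definition punctured_surface (R : realType) (g m : nat) : set (R * R * R) :=
  closed_surface R g `\` [set puncture R g k | k in [set k | (k < m)%N]].

Arguments punctured_surface : clear implicits.

Definition finite_type (R : realType) (g m : nat) (X : riemann_surface R) : Prop :=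
  exists (Y : riemann_surface R) (P : set Y) (h : X -> Y),
    [/\ compact [set: Y], homeomorphic (closed_surface R g) [set: Y],
        (P #= `I_m)%card, holomorphic_map h & injective h /\ range h = ~` P].

(* h, defined near z0, maps small circles around z0 to curves of winding number
   1 around h z0; for a homeomorphism between plane open sets, this means that
   h preserves the orientation near z0. *)
Definition positive_at (R : realType) (h : Cplx R -> Cplx R) (z0 : Cplx R) : Prop :=
  \forall e \near (0 : R)^'+, exists theta : R -> R,
    [/\ continuous theta, theta (2 * pi) = theta 0 + 2 * pi &
        forall t : R,
          let w : Cplx R := h (z0 + e%:C * (cos t +i* sin t)) - h z0 in
          w = `|w| * (cos (theta t) +i* sin (theta t))].

(* The surfaces in R^3 above are oriented by the outward normal, i.e. as the
   boundary of the handlebody z^2 <= handle_poly g x y.  On the open part z > 0,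
   the projection to the (x, y)-plane is a positively oriented chart, with
   inverse [upper_sheet]; as the surface is connected, the orientation character
   of a homeomorphism may be tested on this part. *)
Definition upper_sheet (R : realType) (g : nat) (z : Cplx R) : R * R * R :=
  (complex.Re z, complex.Im z,
   Num.sqrt (handle_poly g (complex.Re z) (complex.Im z))).

Definition orientation_preserving (R : realType) (g : nat)
    (X : riemann_surface R) (f : R * R * R -> X) : Prop :=
  forall (z : Cplx R) j,
    0 < handle_poly g (complex.Re z) (complex.Im z) ->
    dom X j (f (upper_sheet g z)) ->
    positive_at (fun w => chart X j (f (upper_sheet g w))) z.

Record marked_surface (R : realType) (g m : nat) := MarkedSurface {
  surface :> riemann_surface R ;
  marking : R * R * R -> surface ;
  surface_finite_type : finite_type g m surface ;
  marking_homeo : exists k,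
    homeo_on (punctured_surface R g m) [set: surface] marking k ;
  marking_orientation : orientation_preserving g marking
}.

(* h realizes the equality of the points [x] and [y] of Teichmuller space. *)
Definition teich_equiv_by (R : realType) (g m : nat)
    (x y : marked_surface R g m) (h : x -> y) : Prop :=
  biholomorphism h /\
  homotopic_on R (punctured_surface R g m) (h \o @marking R g m x)
    (@marking R g m y).

(* A differential is given by its coefficient functions in the charts, the i-th
   one being extended by 0 outside [img X i]. *)
Definition coeffs (R : realType) := nat -> Cplx R -> Cplx R.

Definition supported (R : realType) (X : riemann_surface R) (a : coeffs R) : Prop :=
  forall i z, ~ img X i z -> a i z = 0.

Definition transition (R : realType) (X : riemann_surface R) (i j : nat) :
  Cplx R -> Cplx R := chart X j \o param X i.

(* phi_i dz_i^2 = phi_j dz_j^2 *)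
Definition quadratic_differential (R : realType) (X : riemann_surface R)
    (phi : coeffs R) : Prop :=
  forall i j z, img X i z -> dom X j (param X i z) ->
    phi i z = phi j (transition X i j z) * derive1 (transition X i j) z ^+ 2.

(* mu_i d(conj z_i)/dz_i = mu_j d(conj z_j)/dz_j *)
Definition beltrami_form (R : realType) (X : riemann_surface R)
    (mu : coeffs R) : Prop :=
  forall i j z, img X i z -> dom X j (param X i z) ->
    mu i z = mu j (transition X i j z) *
      ((derive1 (transition X i j) z)^* / derive1 (transition X i j) z).

Definition pt (R : realType) (w : R * R) : Cplx R := w.1 +i* w.2.

(* The images by the charts of the sets dom 0, dom 1 \ dom 0,
   dom 2 \ (dom 0 \cup dom 1), ..., which form a partition of X. *)
Definition piece (R : realType) (X : riemann_surface R) (i : nat) : set (R * R) :=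
  [set w | img X i (pt w) /\
           forall j, (j < i)%N -> ~ dom X j (param X i (pt w))].

Definition L1norm_ereal (R : realType) (X : riemann_surface R)
    (phi : coeffs R) : \bar R :=
  (\sum_(0 <= i <oo)
     \int[(@lebesgue_measure R \x @lebesgue_measure R)]_(w in piece X i)
       (ComplexField.Normc.normc (phi i (pt w)))%:E)%E.

Definition L1norm (R : realType) (X : riemann_surface R) (phi : coeffs R) : R :=
  fine (L1norm_ereal X phi).

Definition real_surface_integral (R : realType) (X : riemann_surface R)
    (a : nat -> Cplx R -> R) : R :=
  limn (series (fun i =>
    \int[(@lebesgue_measure R \x @lebesgue_measure R)%E]_(w in piece X i)
      a i (pt w))).

(* The integral over X of the (1,1)-form a_i dx dy. *)
Definition surface_integral (R : realType) (X : riemann_surface R)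
    (a : coeffs R) : Cplx R :=
  real_surface_integral X (fun i z => complex.Re (a i z)) +i*
  real_surface_integral X (fun i z => complex.Im (a i z)).

Definition A2 (R : realType) (X : riemann_surface R) : set (coeffs R) :=
  [set phi | [/\ supported X phi, quadratic_differential X phi,
     forall i z, img X i z -> derivable (phi i) z 1 &
     (L1norm_ereal X phi < +oo)%E]].

Definition Linfty (R : realType) (X : riemann_surface R) : set (coeffs R) :=
  [set mu | [/\ supported X mu, beltrami_form X mu,
     forall i, measurable_fun [set: R * R] (fun w => complex.Re (mu i (pt w))) /\
               measurable_fun [set: R * R] (fun w => complex.Im (mu i (pt w))) &
     exists M : R, forall i z, ComplexField.Normc.normc (mu i z) <= M]].

Definition int_pairing (R : realType) (X : riemann_surface R)
    (mu phi : coeffs R) : Cplx R :=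
  surface_integral X (fun i z => mu i z * phi i z).

Definition Ninfty (R : realType) (X : riemann_surface R) : set (coeffs R) :=
  [set mu | Linfty X mu /\ forall phi, A2 X phi -> int_pairing X mu phi = 0].

(* Tangent vectors are the cosets of [Ninfty X] in [Linfty X]. *)
Definition tclass (R : realType) (X : riemann_surface R) (mu : coeffs R) :
  set (coeffs R) := [set nu | Linfty X nu /\ Ninfty X (nu - mu)].

Definition tangent (R : realType) (X : riemann_surface R) : set (set (coeffs R)) :=
  [set tclass X mu | mu in Linfty X].

(* The integral does not depend on the representative chosen by [xget]. *)
Definition pairing (R : realType) (X : riemann_surface R)
    (v : set (coeffs R)) (phi : coeffs R) : Cplx R :=
  int_pairing X (xget 0 v) phi.

(* mu = h^* nu *)
Definition beltrami_pullback (R : realType) (X Y : riemann_surface R)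
    (h : X -> Y) (nu mu : coeffs R) : Prop :=
  forall i j z, img X i z -> dom Y j (h (param X i z)) ->
    mu i z = nu j (in_charts h i j z) *
      ((derive1 (in_charts h i j) z)^* / derive1 (in_charts h i j) z).

(* A real 1-form on Teichmuller space, not necessarily continuous: a real linear
   form on each tangent space, independent of the representative (X, f) of the
   point.  The values of [form x] outside [tangent x] are irrelevant. *)
Record one_form (R : realType) (g m : nat) := OneForm {
  form :> forall x : marked_surface R g m, set (coeffs R) -> R ;
  form_linear : forall (x : marked_surface R g m) (c : R) (mu nu : coeffs R),
    Linfty x mu -> Linfty x nu ->
    form x (tclass x (c%:C *: mu + nu)) =
    c * form x (tclass x mu) + form x (tclass x nu) ;
  form_invariant : forall (x y : marked_surface R g m) (h : x -> y)
      (mu nu : coeffs R),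
    teich_equiv_by h -> Linfty x mu -> Linfty y nu ->
    beltrami_pullback h nu mu ->
    form x (tclass x mu) = form y (tclass y nu)
}.

(* [sup] is 0 on sets that are empty or unbounded.  The set below is bounded by
   the sup norm of a representative of v, and nonempty whenever A2 X contains a
   nonzero differential, that is for all types (g, m) but (0, m), m <= 3. *)
Definition teich_metric (R : realType) (X : riemann_surface R)
    (v : set (coeffs R)) : R :=
  sup [set complex.Re (pairing X v phi) |
        phi in [set phi | A2 X phi /\ L1norm X phi = 1]].

Definition represented_by (R : realType) (g m : nat) (omega : one_form R g m)
    (x : marked_surface R g m) (psi : coeffs R) : Prop :=
  A2 x psi /\
  forall v, tangent x v -> omega x v = complex.Re (pairing x v psi).

Definition form_norm (R : realType) (g m : nat) (omega : one_form R g m)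
    (x : marked_surface R g m) : R :=
  sup [set omega x v | v in [set v | tangent x v /\ teich_metric x v <= 1]].

Definition randers_metric (R : realType) (g m : nat) (omega : one_form R g m)
    (x : marked_surface R g m) (v : set (coeffs R)) : R :=
  teich_metric x v + omega x v.

Definition randers_cometric (R : realType) (g m : nat) (omega : one_form R g m)
    (x : marked_surface R g m) (phi : coeffs R) : R :=
  sup [set complex.Re (pairing x v phi) |
        v in [set v | tangent x v /\ randers_metric omega x v = 1]].

(* Main.v *)
Require Import Defs.
From HB Require Import structures.
From mathcomp Require Import all_boot all_order all_algebra.
From mathcomp Require Import complex.
From mathcomp Require Import all_classical all_reals all_analysis.
From mathcomp Require Import measurable_realfun ring lra.

Import Order.TTheory GRing.Theory Num.Theory numFieldNormedType.Exports.
Local Open Scope classical_set_scope.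
Local Open Scope ring_scope.
Local Open Scope complex_scope.

(* If t > 0 and |phi/t - psi| <= 1 in the L1 norm, then every v with
   kappa(v) + omega(v) = 1 satisfies
     Re<v, phi>/t = Re<v, phi/t - psi> + Re<v, psi> <= kappa(v) + omega(v) = 1,
   so G_omega(phi) <= t.  If phi <> 0, the continuous function |s phi - psi| of s
   is < 1 at 0 and unbounded, hence equals 1 at some S > 0.  Put
   eta = S phi - psi.  The Teichmuller-Beltrami form mu = |eta|/eta satisfies
   Re<mu, eta> = kappa([mu]) = 1, so that
   S Re<mu, phi> = 1 + Re<mu, psi> = (kappa + omega)([mu]) >= 1 - |psi| > 0.
   After normalization, [mu] attains the bound 1/S; thus
   G_omega(phi) = 1/S is the least element of the set of admissible t. *)

Set Implicit Arguments.
Unset Strict Implicit.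
Unset Printing Implicit Defensive.

Local Notation normc := (@ComplexField.Normc.normc _).
Local Notation leb2 := (@lebesgue_measure _ \x @lebesgue_measure _)%E.

(* [lebesgue_measure] lives on [measurableTypeR R], whose measurable sets are
   those of R but whose display is different; on this product type the
   measurability facts below apply to the surface integrals without casts. *)
Local Notation plane R := (measurableTypeR R * measurableTypeR R)%type.

(** * Borel measurability in the plane *)

Section Plane.
Variable R : realType.
Implicit Types (z : Cplx R) (w : R * R).

Lemma normc_Re z : `|complex.Re z| <= normc z.
Proof. by case: z => a b /=; rewrite -sqrtr_sqr ler_wsqrtr// lerDl sqr_ge0. Qed.

Lemma normc_Im z : `|complex.Im z| <= normc z.
Proof. by case: z => a b /=; rewrite -sqrtr_sqr ler_wsqrtr// lerDr sqr_ge0. Qed.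

Lemma normc_ge0 z : 0 <= normc z.
Proof. exact: le_trans (normr_ge0 _) (normc_Re z). Qed.

Lemma normc_le_sum z : normc z <= `|complex.Re z| + `|complex.Im z|.
Proof.
case: z => a b /=.
rewrite -[leRHS]ger0_norm ?addr_ge0// -sqrtr_sqr ler_wsqrtr// sqrrD !real_normK ?num_real//.
by rewrite lerD2r lerDl mulrn_wge0// mulr_ge0.
Qed.

Lemma Re_continuous : continuous (@complex.Re R : Cplx R -> R).
Proof.
move=> z A /nbhs_ballP [e /= e0 eA]; apply/nbhs_ballP.
(* Balls of [Cplx R] have radii in [R[i]], where a positive element is a positive real. *)
exists (e%:C) => /=; first by rewrite ltcR.
move=> y; rewrite /ball/= => zy; apply: eA; rewrite /ball/=.
have := zy; rewrite ltcE => /andP[_ /= zye].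
by apply: le_lt_trans zye; rewrite -raddfB; exact: normc_Re.
Qed.

Lemma Im_continuous : continuous (@complex.Im R : Cplx R -> R).
Proof.
move=> z A /nbhs_ballP [e /= e0 eA]; apply/nbhs_ballP.
exists (e%:C) => /=; first by rewrite ltcR.
move=> y; rewrite /ball/= => zy; apply: eA; rewrite /ball/=.
have := zy; rewrite ltcE => /andP[_ /= zye].
by apply: le_lt_trans zye; rewrite -raddfB; exact: normc_Im.
Qed.

Lemma normc_continuous : continuous (normc : Cplx R -> R).
Proof.
move=> z; apply: (@continuous_comp _ _ _ (fun y : Cplx R => `|y|) (@complex.Re R : Cplx R -> R)).
  exact: norm_continuous.
exact: Re_continuous.
Qed.

Lemma pt_continuous : continuous (@pt R).
Proof.
move=> w A /nbhs_ballP [e /= e0 eA]; apply/nbhs_ballP.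
have er : e = (complex.Re e)%:C.
  by case: e e0 {eA} => a b; rewrite ltcE /= => /andP[/eqP -> _].
have e0' : 0 < complex.Re e by move: e0; rewrite er ltcR.
exists (complex.Re e / 2) => /=; first by rewrite divr_gt0.
move=> y [] /= y1 y2; apply: eA; rewrite /ball/= er ltcE /= eqxx/=.
apply: le_lt_trans (normc_le_sum (pt w - pt y)) _.
rewrite /pt/= [ltRHS](splitr (complex.Re e)).
exact: ltrD.
Qed.

(** An open set is the union of the squares with rational centre and radius that it contains:
    countably many, each a product of measurable intervals. *)
Lemma open_plane_measurable (W : set (R * R)) :
  open W -> measurable (W : set (plane R)).
Proof.
move=> oW.
pose box (q : rat * rat * rat) : set (R * R) :=
  ball (ratr q.1.1 : R) (ratr q.2) `*` ball (ratr q.1.2 : R) (ratr q.2).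
have -> : W = \bigcup_q (if `[< box q `<=` W >] then box q else set0).
  apply/seteqP; split => [w Ww|w [q _]]; last by case: ifP => // /asboolP; exact.
  move: oW; rewrite openE => /(_ _ Ww) /nbhs_ballP [e /= e0 eW].
  have e2 : 0 < e / 2 by rewrite divr_gt0.
  (* Since r < e / 2, a square of radius r whose centre is within r of w contains w and stays within
     e of w. *)
  have [r /andP[r0 re]] : exists r : rat, 0 < (ratr r : R) < e / 2.
    by have [r] := rat_in_itvoo e2; rewrite in_itv; exists r.
  have near_rat (t : R) : exists q : rat, `|(ratr q : R) - t| < ratr r.
    have : t < t + ratr r by rewrite ltrDl.
    move=> /rat_in_itvoo [q]; rewrite in_itv /= => /andP[tq qt].
    by exists q; rewrite gtr0_norm ?subr_gt0// ltrBlDl.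
  have [a aw] := near_rat w.1; have [b bw] := near_rat w.2.
  exists (a, b, r) => //; case: ifPn => [_|/asboolP[]]; first by split.
  move=> y [/= y1 y2]; apply: eW; rewrite [e]splitr.
  split => /=; [apply: (@ball_triangle _ _ (ratr a : R))|
    apply: (@ball_triangle _ _ (ratr b : R))].
  - by apply: ball_sym; apply: (le_ball (ltW re)).
  - by apply: (le_ball (ltW re)).
  - by apply: ball_sym; apply: (le_ball (ltW re)).
  - by apply: (le_ball (ltW re)).
apply: countable_bigcupT_measurable => // q; case: ifP => // _.
by apply: measurableX; apply: open_measurable; exact: ball_open.
Qed.

(** The function f may jump at the boundary of U. However, f composed with [pt] is the extension by
    0 of its restriction to an open set, on which preimages of open intervals are open. *)
Lemma measurable_fun_pt (U : set (Cplx R)) (f : Cplx R -> R) : open U ->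
  (forall z, U z -> {for z, continuous f}) -> (forall z, ~ U z -> f z = 0) ->
  measurable_fun [set: plane R] (f \o @pt R).
Proof.
move=> oU cf f0.
have oU' : open (@pt R @^-1` U) by apply: open_comp => // w _; exact: pt_continuous.
have mU := open_plane_measurable oU'.
have -> : f \o @pt R = (f \o @pt R) \_ (@pt R @^-1` U).
  by apply/funext => w; rewrite patchE; case: ifPn => // /negP; rewrite inE => /f0.
apply: (iffLR (measurable_restrictT _ mU)).
apply: (measurability _ (RGenOpens.measurableE R)) => _ [_ [a [b ->]] <-].
apply: open_plane_measurable; rewrite openE => w [Uw abw].
have : nbhs w (@pt R @^-1` U) by apply: open_nbhs_nbhs; split.
have cw : {for w, continuous (f \o @pt R)}.
  by apply: continuous_comp; [exact: pt_continuous|apply: cf; exact: Uw].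
have /cw : nbhs ((f \o @pt R) w) `]a, b[%classic.
  by apply: open_nbhs_nbhs; split => //; exact: interval_open.
by move=> h1 h2; apply: filterI.
Qed.

Lemma measurable_fun_normc d (T : measurableType d) (f : T -> Cplx R) :
  measurable_fun setT (@complex.Re R \o f) -> measurable_fun setT (@complex.Im R \o f) ->
  measurable_fun setT (normc \o f).
Proof.
move=> mr mi.
have -> : normc \o f = Num.sqrt \o (fun x => (complex.Re (f x)) ^+ 2 + (complex.Im (f x)) ^+ 2).
  by apply/funext => x /=; case: (f x).
apply: measurableT_comp.
  by apply: continuous_measurable_fun; exact: sqrt_continuous.
by apply: measurable_funD; exact: measurable_funX.
Qed.

(** On nonnegative reals the inverse is the power of exponent -1, even at 0, where both take the
    value 0. *)
Lemma measurable_fun_inv d (T : measurableType d) (f : T -> R) :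
  (forall x, 0 <= f x) -> measurable_fun setT f -> measurable_fun setT (fun x => (f x)^-1).
Proof.
move=> f0 mf.
have -> : (fun x => (f x)^-1) = (@powR R)^~ (-1) \o f by apply/funext => x /=; rewrite powR_inv1.
exact: measurableT_comp (measurable_powR _) mf.
Qed.

End Plane.

(** * Summable densities on a Riemann surface *)

Section Surface.
Variables (R : realType) (X : riemann_surface R).
Implicit Types a b : nat -> Cplx R -> R.

(** As [param X i] is continuous only on [img X i], the preimage of [dom X j] is cut down to that
    open set. *)
Lemma open_overlap i j : open [set z | img X i z /\ dom X j (param X i z)].
Proof.
rewrite openE => z [iz jz].
have [_ _ _ cp] := @chart_homeo _ X i.
have {}cp : {for z, continuous (param X i)}.
  by move: cp; rewrite continuous_open_subspace; [apply; rewrite inE|exact: img_open].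
have /cp jnz : nbhs (param X i z) (dom X j).
  by apply: open_nbhs_nbhs; split => //; exact: dom_open.
have iz' : nbhs z (img X i) by apply: open_nbhs_nbhs; split => //; exact: img_open.
exact: filterI.
Qed.

Lemma measurable_piece i : measurable (piece X i : set (plane R)).
Proof.
have -> : piece X i = (@pt R @^-1` img X i) `&` ~` (\bigcup_(j < i)
    (@pt R @^-1` [set z | img X i z /\ dom X j (param X i z)])).
  apply/seteqP; split => w [iw jw]; split => //.
    by move=> [j /= ji [_]]; exact: jw.
  by move=> j ji jd; apply: jw; exists j.
have mopen (U : set (Cplx R)) : open U -> measurable (@pt R @^-1` U : set (plane R)).
  move=> oU; apply: open_plane_measurable; apply: open_comp => // w _.
  exact: pt_continuous.
apply: measurableI; first by apply: mopen; exact: img_open.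
apply: measurableC; apply: bigcup_measurable => j _.
by apply: mopen; exact: open_overlap.
Qed.

(** Absolute integrability over X, piece by piece. Outside this class [real_surface_integral] may be
    a default value of [Rintegral] or [limn]; within it the integral is linear and monotone. *)
Definition summable_density (a : nat -> Cplx R -> R) : Prop :=
  (forall i, leb2.-integrable (piece X i) (fun w => (a i (pt w))%:E)) /\
  cvgn (series (fun i => \int[leb2]_(w in piece X i) `|a i (pt w)|)).

Local Notation RS := (@real_surface_integral R X).

Lemma summable_density_cvg a : summable_density a ->
  cvgn (series (fun i => \int[leb2]_(w in piece X i) a i (pt w))).
Proof.
move=> [ia ca]; apply: normed_cvg; apply: series_le_cvg ca => i /=.
- exact: normr_ge0.
- by apply: Rintegral_ge0 => w _.
- by apply: le_normr_Rintegral; [exact: measurable_piece|exact: ia].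
Qed.

Lemma summable_density_le a b : (forall i, measurable_fun [set: plane R] (a i \o @pt R)) ->
  (forall i z, `|a i z| <= b i z) -> summable_density b -> summable_density a.
Proof.
move=> ma ab [ib cb].
have ia i : leb2.-integrable (piece X i) (fun w => (a i (pt w))%:E).
  apply: (le_integrable _ _ _ (ib i)); first exact: measurable_piece.
    by apply/measurable_EFinP; apply: measurable_funTS; exact: ma.
  by move=> w _ /=; rewrite lee_fin; apply: le_trans (ab _ _) (ler_norm _).
split; first exact: ia.
apply: series_le_cvg cb => i.
- by apply: Rintegral_ge0 => w _.
- by apply: Rintegral_ge0 => w _.
- apply: le_Rintegral => //; first exact: measurable_piece.
  + by apply: integrable_norm; exact: ia.
  + by apply: integrable_norm; exact: ib.
  + by move=> w _; apply: le_trans (ab _ _) (ler_norm _).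
Qed.

(** The form c a + b also covers scaling and negation, through c a = (c - 1) a + a and - a = (-2) a
    + a; this is how it is applied below. Summability follows by domination with |c| |a| + |b|. *)
Lemma summable_density_lin (c : R) a b : summable_density a -> summable_density b ->
  summable_density (fun i z => c * a i z + b i z) /\
  RS (fun i z => c * a i z + b i z) = c * RS a + RS b.
Proof.
move=> sa sb; have [ia ca] := sa; have [ib cb] := sb.
have mp := measurable_piece.
have ica i : leb2.-integrable (piece X i) (fun w => (c * a i (pt w))%:E).
  exact: (integrableZl (mp i) c (ia i)).
have ilin i : leb2.-integrable (piece X i) (fun w => (c * a i (pt w) + b i (pt w))%:E).
  exact: (integrableD (mp i) (ica i) (ib i)).
split; last first.
  rewrite /RS /real_surface_integral.
  pose I (f : nat -> Cplx R -> R) : R^o ^nat :=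
    fun i => \int[leb2]_(w in piece X i) f i (pt w).
  have -> : (fun i => \int[leb2]_(w in piece X i) (c * a i (pt w) + b i (pt w))) =
      c *: I a + I b.
    by apply/funext => i; rewrite RintegralD// RintegralZl.
  have cIa := summable_density_cvg sa; have cIb := summable_density_cvg sb.
  rewrite (lim_seriesD (is_cvg_seriesZ cIa) cIb).
  by rewrite (lim_seriesZ _ cIa).
split; first exact: ilin.
have cs := is_cvg_seriesD (is_cvg_seriesZ (k := `|c|) ca) cb.
apply: series_le_cvg cs => i.
- by apply: Rintegral_ge0 => w _.
- by rewrite addr_ge0// ?mulr_ge0//; apply: Rintegral_ge0 => w _.
- have iZ := integrableZl (mp i) `|c| (integrable_norm (ia i)).
  have iD := integrableD (mp i) iZ (integrable_norm (ib i)).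
  rewrite -[leRHS]/(`|c| * _ + _) -RintegralZl//; last exact: (integrable_norm (ia i)).
  rewrite -RintegralD//; last exact: (integrable_norm (ib i)).
  apply: le_Rintegral => //; first exact: (integrable_norm (ilin i)).
  by move=> w _; rewrite -normrM; exact: ler_normD.
Qed.

Lemma real_surface_integral_le a b : summable_density a -> summable_density b ->
  (forall i z, a i z <= b i z) -> RS a <= RS b.
Proof.
move=> sa sb ab; apply: lim_series_le; try exact: summable_density_cvg.
move=> i; apply: le_Rintegral => //; first exact: measurable_piece.
- exact: sa.1.
- exact: sb.1.
Qed.

End Surface.

(** * Integrable holomorphic quadratic differentials *)

Lemma eseries_EFin (R : realType) (u : nat -> R) : cvgn (series u) ->
  (\sum_(0 <= i <oo) (u i)%:E)%E = (limn (series u))%:E.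
Proof.
move=> cu; rewrite -EFin_lim//; congr (limn _); apply/funext => n /=.
by rewrite sumEFin.
Qed.

Section Differentials.
Variables (R : realType) (X : riemann_surface R).
Implicit Types (phi psi mu nu : coeffs R) (c : R).

Lemma normc_real_mul c (z : Cplx R) : normc (c%:C * z) = `|c| * normc z.
Proof. by rewrite ComplexField.Normc.normcM /= expr0n addr0 sqrtr_sqr. Qed.

Lemma Re_real_mul c (z : Cplx R) : complex.Re (c%:C * z) = c * complex.Re z.
Proof. by case: z => a b /=; rewrite mul0r subr0. Qed.

Lemma Im_real_mul c (z : Cplx R) : complex.Im (c%:C * z) = c * complex.Im z.
Proof. by case: z => a b /=; rewrite mul0r addr0. Qed.

Lemma holomorphic_continuous phi i z : A2 X phi -> img X i z ->
  {for z, continuous (phi i : Cplx R -> Cplx R)}.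
Proof.
by move=> [_ _ hol _] iz; apply: differentiable_continuous; apply/derivable1_diffP; exact: hol.
Qed.

Lemma A2_measurable phi i : A2 X phi ->
  measurable_fun [set: plane R] (fun w => complex.Re (phi i (pt w))) /\
  measurable_fun [set: plane R] (fun w => complex.Im (phi i (pt w))).
Proof.
move=> Aphi; have [sphi _ _ _] := Aphi.
split.
- apply: (@measurable_fun_pt _ (img X i) (fun z => complex.Re (phi i z))).
  + exact: img_open.
  + move=> z iz; apply: continuous_comp; first exact: holomorphic_continuous.
    exact: Re_continuous.
  + by move=> z /sphi ->.
- apply: (@measurable_fun_pt _ (img X i) (fun z => complex.Im (phi i z))).
  + exact: img_open.
  + move=> z iz; apply: continuous_comp; first exact: holomorphic_continuous.
    exact: Im_continuous.
  + by move=> z /sphi ->.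
Qed.

Lemma A2_measurable_normc phi i : A2 X phi ->
  measurable_fun [set: plane R] (fun w => normc (phi i (pt w))).
Proof.
move=> /(A2_measurable i)[mr mi].
exact: (measurable_fun_normc (f := fun w : plane R => phi i (pt w))).
Qed.

Lemma integral_piece_le phi i :
  (\int[leb2]_(w in piece X i) (normc (phi i (pt w)))%:E <= L1norm_ereal X phi)%E.
Proof.
pose I i := (\int[leb2]_(w in piece X i) (normc (phi i (pt w)))%:E)%E.
have I0 j : (0 <= I j)%E by apply: integral_ge0 => w _; rewrite lee_fin normc_ge0.
rewrite -[leRHS]/(\sum_(0 <= k <oo) I k)%E.
by rewrite (nneseriesD1 (n := i))// leeDl// nneseries_ge0.
Qed.

(** Passes from the extended-real sum defining the norm to a real series: a finite norm makes every
    term finite and the series convergent. Norms and pairings then become integrals of the same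
    kind. *)
Lemma A2_density phi : A2 X phi ->
  summable_density X (fun i z => normc (phi i z)) /\
  L1norm X phi = real_surface_integral X (fun i z => normc (phi i z)).
Proof.
move=> Aphi; have [_ _ _ foo] := Aphi.
have mN i := A2_measurable_normc i Aphi.
pose I i := (\int[leb2]_(w in piece X i) (normc (phi i (pt w)))%:E)%E.
have I0 i : (0 <= I i)%E by apply: integral_ge0 => w _; rewrite lee_fin normc_ge0.
have Ioo i : (I i < +oo)%E by exact: le_lt_trans (integral_piece_le phi i) foo.
have ii i : leb2.-integrable (piece X i) (fun w => (normc (phi i (pt w)))%:E).
  apply/integrableP; split.
    by apply/measurable_EFinP; apply: measurable_funTS; exact: mN.
  under eq_integral do rewrite /= ger0_norm ?normc_ge0//.
  exact: Ioo.
pose u i := fine (I i).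
have uE i : I i = (u i)%:E by rewrite fineK// ge0_fin_numE.
have u0 i : 0 <= u i by exact: fine_ge0.
have LE : L1norm_ereal X phi = (\sum_(0 <= i <oo) (u i)%:E)%E.
  by apply: eq_eseriesr => i _; exact: uE.
have cu : cvgn (series u).
  by apply: nnseries_is_cvg => //; rewrite -LE.
split.
  split; first exact: ii.
  have -> // : (fun i => \int[leb2]_(w in piece X i) `|normc (phi i (pt w))|) = u.
  apply/funext => i; apply: eq_Rintegral => w _.
  by rewrite ger0_norm ?normc_ge0.
rewrite /L1norm LE /real_surface_integral.
by rewrite eseries_EFin.
Qed.

Lemma A2I phi : supported X phi -> quadratic_differential X phi ->
  (forall i z, img X i z -> derivable (phi i) z 1) ->
  summable_density X (fun i z => normc (phi i z)) -> A2 X phi.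
Proof.
move=> sphi qphi hphi [ii ci]; split=> //; rewrite /L1norm_ereal.
pose u i : R := \int[leb2]_(w in piece X i) normc (phi i (pt w)).
have -> : (\sum_(0 <= i <oo)
    \int[leb2]_(w in piece X i) (normc (phi i (pt w)))%:E)%E = (limn (series u))%:E.
  rewrite -eseries_EFin.
    apply: eq_eseriesr => i _; rewrite /u /Rintegral fineK//.
    by apply: integrable_fin_num => //; exact: measurable_piece.
  rewrite (_ : u = fun i => \int[leb2]_(w in piece X i) `|normc (phi i (pt w))|)//.
  apply/funext => i; apply: eq_Rintegral => w _.
  by rewrite ger0_norm ?normc_ge0.
exact: ltry.
Qed.

Lemma L1norm_ge0 phi : A2 X phi -> 0 <= L1norm X phi.
Proof.
move=> Aphi; rewrite /L1norm fine_ge0//; apply: nneseries_ge0 => i _ _.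
by apply: integral_ge0 => w _; rewrite lee_fin normc_ge0.
Qed.

(** The pointwise triangle inequality dominates the density of the combination by a summable one;
    integrating it yields the bound on norms. *)
Lemma A2_lin c phi psi : A2 X phi -> A2 X psi -> A2 X (c%:C *: phi + psi) /\
  L1norm X (c%:C *: phi + psi) <= `|c| * L1norm X phi + L1norm X psi.
Proof.
move=> Aphi Apsi.
have [sphi ephi] := A2_density Aphi; have [spsi epsi] := A2_density Apsi.
have [slin elin] := summable_density_lin `|c| sphi spsi.
have [zphi qphi hphi _] := Aphi; have [zpsi qpsi hpsi _] := Apsi.
have le_lin i z : normc ((c%:C *: phi + psi) i z) <= `|c| * normc (phi i z) + normc (psi i z).
  by rewrite -normc_real_mul; exact: le_normcD.
have dlin : summable_density X (fun i z => normc ((c%:C *: phi + psi) i z)).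
  apply: summable_density_le slin => [i|i z]; last by rewrite ger0_norm ?normc_ge0.
  have [mr mi] := A2_measurable i Aphi; have [mr' mi'] := A2_measurable i Apsi.
  apply: (measurable_fun_normc (f := fun w : plane R => (c%:C *: phi + psi) i (pt w))).
  - rewrite (_ : _ \o _ = fun w => c * complex.Re (phi i (pt w)) + complex.Re (psi i (pt w))).
      by apply: measurable_funD => //; exact: measurable_funM.
    by apply/funext => w /=; rewrite -Re_real_mul -raddfD.
  - rewrite (_ : _ \o _ = fun w => c * complex.Im (phi i (pt w)) + complex.Im (psi i (pt w))).
      by apply: measurable_funD => //; exact: measurable_funM.
    by apply/funext => w /=; rewrite -Im_real_mul -raddfD.
have Alin : A2 X (c%:C *: phi + psi).
  apply: A2I dlin.
  - move=> i z iz; rewrite -[LHS]/(c%:C * phi i z + psi i z) zphi// zpsi//.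
    by rewrite mulr0 addr0.
  - move=> i j z iz jz; rewrite -[LHS]/(c%:C * phi i z + psi i z) (qphi _ _ _ iz jz).
    by rewrite (qpsi _ _ _ iz jz) mulrA -mulrDl.
  - move=> i z iz; apply: derivableD; last exact: hpsi.
    by apply: derivableZ; exact: hphi.
split; first exact: Alin.
rewrite (A2_density Alin).2 ephi epsi -elin.
exact: real_surface_integral_le.
Qed.

Lemma scale_subr1 c phi : c%:C *: phi = (c - 1)%:C *: phi + phi.
Proof. by rewrite -[X in _ + X]scale1r -scalerDl -(rmorph1 (real_complex R)) -rmorphD subrK. Qed.

Lemma A2Z c phi : A2 X phi -> A2 X (c%:C *: phi) /\
  L1norm X (c%:C *: phi) = `|c| * L1norm X phi.
Proof.
move=> Aphi; have [sphi ephi] := A2_density Aphi.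
have Acphi : A2 X (c%:C *: phi).
  by rewrite scale_subr1; exact: (A2_lin _ Aphi Aphi).1.
split=> //; rewrite (A2_density Acphi).2 ephi.
have := (summable_density_lin (`|c| - 1) sphi sphi).2.
rewrite mulrBl mul1r subrK => <-; congr real_surface_integral.
apply/funext => i; apply/funext => z.
by rewrite -[X in normc X]/(c%:C * phi i z) normc_real_mul mulrBl mul1r subrK.
Qed.

Lemma A2N phi : A2 X phi -> A2 X (- phi) /\ L1norm X (- phi) = L1norm X phi.
Proof. by move=> /(A2Z (-1)); rewrite rmorphN1 scaleN1r normrN1 mul1r. Qed.

Lemma A2B c phi psi : A2 X phi -> A2 X psi -> A2 X (c%:C *: phi - psi).
Proof. by move=> Aphi Apsi; exact: (A2_lin c Aphi (A2N Apsi).1).1. Qed.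

(* For the least index k with phi_k <> 0, the points where phi_k does not vanish
   lie in no chart of smaller index, so they form an open subset of [piece X k]. *)
Lemma L1norm_eq0 phi : A2 X phi -> L1norm X phi = 0 -> phi = 0.
Proof.
move=> Aphi n0; have [sphi qphi _ foo] := Aphi.
apply: contrapT => phi0.
have exk : exists k, `[< exists z, phi k z <> 0 >].
  apply: contrapT => nk; apply: phi0.
  apply/funext => i; apply/funext => z; apply: contrapT => ne.
  by apply: nk; exists i; apply/asboolP; exists z.
case: (ex_minnP exk) => k /asboolP[z0 z0k] mink {exk phi0}.
have k_img z : phi k z <> 0 -> img X k z.
  by move=> pz; apply: contrapT => /sphi.
have k_piece w : phi k (pt w) <> 0 -> piece X k w.
  move=> pw; split=> [|j jk jd]; first exact: k_img.
  (* If the point lay in a chart j < k, then phi_j would vanish there by minimality of k, and the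
     transformation rule would make phi_k vanish too. *)
  have jmin : `[< exists z, phi j z <> 0 >] -> False.
    by move=> /mink; rewrite leqNgt jk.
  apply: jmin; apply/asboolP; exists (transition X k j (pt w)) => j0.
  by apply: (pw); rewrite (qphi k j _ (k_img _ pw) jd) j0 mul0r.
pose N := normc (phi k z0); pose w0 : R * R := (complex.Re z0, complex.Im z0).
have pw0 : pt w0 = z0 by rewrite /w0; clear; case: z0.
have zk : img X k (pt w0) by rewrite pw0; exact: k_img.
have N0 : 0 < N.
  by rewrite lt_neqAle normc_ge0 andbT; apply/eqP => /esym/ComplexField.Normc.eq0_normc.
have : {for w0, continuous (fun w => normc (phi k (pt w)))}.
  apply: (@continuous_comp _ _ _ (fun w => phi k (pt w)) (normc : Cplx R -> R)).
    apply: (@continuous_comp _ _ _ (@pt R) (phi k)); first exact: pt_continuous.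
    exact: holomorphic_continuous Aphi zk.
  exact: normc_continuous.
have nN : nbhs (normc (phi k (pt w0))) `]N / 2, +oo[%classic.
  apply: open_nbhs_nbhs; split; first exact: interval_open.
  by rewrite /= pw0 in_itv /= andbT -/N ltr_pdivrMr// ltr_pMr// ltr1n.
move=> /(_ _ nN)/nbhs_ballP[e /= e0 eN].
(* On the square B around w0 the modulus of phi_k exceeds N / 2, so B lies in the k-th piece and
   contributes at least N / 2 times its area (2e)^2 to the norm. *)
pose B : set (plane R) := ball w0.1 e `*` ball w0.2 e.
have mball (t : R) : measurable (ball t e : set (measurableTypeR R)).
  by apply: open_measurable; exact: ball_open.
have mB : measurable B by exact: measurableX.
have BN w : B w -> N / 2 < normc (phi k (pt w)).
  by move=> Bw; have := eN w Bw; rewrite /= in_itv /= andbT.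
have Bpiece : B `<=` piece X k.
  move=> w /BN Nw; apply: k_piece => p0; move: Nw; rewrite p0.
  by rewrite ComplexField.Normc.normc0 ltNge divr_ge0// ltW.
have := integral_piece_le phi k; apply/negP; rewrite -ltNge.
(* As [fine] also sends +oo to 0, this uses the finiteness of the norm on [A2 X]. *)
have -> : L1norm_ereal X phi = 0%E.
  rewrite -[LHS]fineK ?ge0_fin_numE// -?/(L1norm X phi) ?n0//.
  by apply: nneseries_ge0 => i _ _; apply: integral_ge0 => w _; rewrite lee_fin normc_ge0.
have mN := A2_measurable_normc k Aphi.
apply: (@lt_le_trans _ _ (\int[leb2]_(w in B) (normc (phi k (pt w)))%:E)%E); last first.
  apply: ge0_subset_integral => //; first exact: measurable_piece.
    by apply/measurable_EFinP; apply: measurable_funTS; exact: mN.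
  by move=> w _; rewrite lee_fin normc_ge0.
apply: (@lt_le_trans _ _ (\int[leb2]_(w in B) (N / 2)%:E)%E); last first.
  apply: ge0_le_integral => //.
  - by move=> w _; rewrite lee_fin divr_ge0// ltW.
  - by apply/measurable_EFinP; apply: measurable_funTS; exact: mN.
  - by move=> w /BN Nw; rewrite lee_fin ltW.
have muB : leb2 B = (e *+ 2 * (e *+ 2))%:E.
  apply: (etrans (product_measure1E _ _ (mball w0.1) (mball w0.2))).
  by rewrite EFinM; congr (_ * _)%E; exact: lebesgue_measure_ball (ltW e0).
have muB0 : (0 < leb2 B)%E by rewrite muB lte_fin mulr_gt0// pmulrn_lgt0.
rewrite integral_cst//; apply: mule_gt0; first by rewrite lte_fin divr_gt0.
exact: muB0.
Qed.

Lemma L1norm_crossing phi psi : A2 X phi -> A2 X psi -> phi <> 0 ->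
  L1norm X psi < 1 -> exists2 s : R, 0 < s & L1norm X (s%:C *: phi - psi) = 1.
Proof.
move=> Aphi Apsi phi_neq0 psi1.
set a := L1norm X phi.
have a0 : 0 < a.
  by rewrite lt_neqAle (L1norm_ge0 Aphi) andbT; apply/eqP => /esym/(L1norm_eq0 Aphi).
pose N (s : R) := L1norm X (s%:C *: phi - psi).
have AN s : A2 X (s%:C *: phi - psi) by exact: A2B.
(* Triangle inequality for s phi - psi = (s - s') phi + (s' phi - psi); exchanging s and s' makes N
   Lipschitz. *)
have Nlip s s' : N s - N s' <= `|s - s'| * a.
  rewrite lerBlDr; have := (A2_lin (s - s') Aphi (AN s')).2.
  by rewrite addrA -scalerDl -rmorphD subrK.
have Ncont : continuous N.
  move=> s; apply/cvgrPdist_lt => e e0; near=> s'.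
  apply: (@le_lt_trans _ _ (`|s - s'| * a)).
    by rewrite ler_norml Nlip lerNl opprB distrC Nlip.
  rewrite -(ltr_pdivlMr _ _ a0); near: s'.
  by apply: (@nbhsx_ballx _ _ s); rewrite divr_gt0.
have N0 : N 0 < 1 by rewrite /N scale0r add0r (A2N Apsi).2.
(* Here s1 phi has norm 2, so N s1 >= 2 - |psi| > 1. *)
pose s1 := 2 / a.
have s10 : 0 <= s1 by rewrite divr_ge0 ?ler0n ?(ltW a0).
have N1 : 1 <= N s1.
  have [_] := A2Z s1 Aphi.
  rewrite -/a (ger0_norm s10) /s1 (divfK (lt0r_neq0 a0)) -/s1 => n2.
  have := (A2_lin 1 (AN s1) Apsi).2.
  rewrite rmorph1 scale1r subrK normr1 mul1r n2 -/(N s1).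
  have arith (p q : R) : p < 1 -> 2 <= q + p -> 1 <= q by clear; lra.
  exact: arith.
have minmax (p q : R) : p < 1 -> 1 <= q -> Num.min p q <= 1 <= Num.max p q.
  by move=> /ltW p1 q1; rewrite ge_min p1 le_max q1 orbT.
have [s] := IVT s10 (continuous_subspaceT Ncont) (minmax _ _ N0 N1).
rewrite in_itv /= => /andP[s_ge0 _] Ns; exists s => //.
rewrite lt_neqAle s_ge0 andbT; apply/eqP => s0.
by move: N0; rewrite s0 Ns ltxx.
Unshelve. all: by end_near.
Qed.

End Differentials.

(** * The pairing with Beltrami forms *)

Section Pairing.
Variables (R : realType) (X : riemann_surface R).
Implicit Types (phi psi mu nu : coeffs R) (c : R).

(** Works with representatives instead of cosets; [pairing_tclass] relates the two. *)
Definition re_pairing mu phi : R := complex.Re (int_pairing X mu phi).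

Lemma pairing_density mu phi (M : R) : Linfty X mu -> A2 X phi ->
  (forall i z, normc (mu i z) <= M) ->
  summable_density X (fun i z => complex.Re (mu i z * phi i z)) /\
  `|re_pairing mu phi| <= M * L1norm X phi.
Proof.
move=> [_ _ mmu _] Aphi muM.
have M0 : 0 <= M by apply: le_trans (normc_ge0 _) (muM 0%N 0).
have [sphi ephi] := A2_density Aphi.
have [sM eM] := summable_density_lin (M - 1) sphi sphi.
have ME : (fun (i : nat) (z : Cplx R) => (M - 1) * normc (phi i z) + normc (phi i z)) =
    fun i z => M * normc (phi i z).
  by apply/funext => i; apply/funext => z; rewrite mulrBl mul1r subrK.
rewrite ME -ephi mulrBl mul1r subrK in sM eM.
have le_M i (z : Cplx R) : `|complex.Re (mu i z * phi i z)| <= M * normc (phi i z).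
  apply: le_trans (normc_Re _) _; rewrite ComplexField.Normc.normcM.
  by rewrite ler_wpM2r// normc_ge0.
have sP : summable_density X (fun i z => complex.Re (mu i z * phi i z)).
  apply: summable_density_le le_M sM => i.
  have [mr mi] := A2_measurable i Aphi; have [mr' mi'] := mmu i.
  rewrite (_ : _ \o _ = fun w => complex.Re (mu i (pt w)) * complex.Re (phi i (pt w)) -
    complex.Im (mu i (pt w)) * complex.Im (phi i (pt w))).
    by apply: measurable_funB; apply: measurable_funM.
  by apply/funext => w /=; case: (mu i _) => ? ?; case: (phi i _).
split=> //; rewrite -eM ler_norml; apply/andP; split.
- rewrite lerNl.
  have [sN eN] := summable_density_lin (-2) sP sP.
  have NE : (fun (i : nat) (z : Cplx R) => -2 * complex.Re (mu i z * phi i z) +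
      complex.Re (mu i z * phi i z)) = fun i z => - complex.Re (mu i z * phi i z).
    by apply/funext => i; apply/funext => z; ring.
  rewrite NE in sN eN.
  rewrite (_ : - re_pairing mu phi = -2 * re_pairing mu phi + re_pairing mu phi); last by ring.
  rewrite -eN; apply: real_surface_integral_le => // i z.
  by apply: le_trans (le_M i z); rewrite -normrN ler_norm.
- by apply: real_surface_integral_le => // i z; apply: le_trans (le_M i z); exact: ler_norm.
Qed.

Lemma Linfty_bound mu : Linfty X mu -> exists M : R, forall i z, normc (mu i z) <= M.
Proof. by case. Qed.

Lemma re_pairing_linr c mu phi psi : Linfty X mu -> A2 X phi -> A2 X psi ->
  re_pairing mu (c%:C *: phi + psi) = c * re_pairing mu phi + re_pairing mu psi.
Proof.
move=> Lmu Aphi Apsi; have [M muM] := Linfty_bound Lmu.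
have [sphi _] := pairing_density Lmu Aphi muM.
have [spsi _] := pairing_density Lmu Apsi muM.
rewrite /re_pairing /= -(summable_density_lin c sphi spsi).2; congr real_surface_integral.
apply/funext => i; apply/funext => z.
by rewrite -[X in mu i z * X]/(c%:C * phi i z + psi i z) mulrDr raddfD /= mulrCA Re_real_mul.
Qed.

Lemma re_pairingZr c mu phi : Linfty X mu -> A2 X phi ->
  re_pairing mu (c%:C *: phi) = c * re_pairing mu phi.
Proof.
move=> Lmu Aphi.
by rewrite scale_subr1 re_pairing_linr// mulrBl mul1r subrK.
Qed.

Lemma re_pairing_subr c mu phi psi : Linfty X mu -> A2 X phi -> A2 X psi ->
  re_pairing mu (c%:C *: phi - psi) = c * re_pairing mu phi - re_pairing mu psi.
Proof.
move=> Lmu Aphi Apsi; rewrite (re_pairing_linr _ Lmu Aphi (A2N Apsi).1).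
by rewrite -[- psi]scaleN1r -(rmorphN1 (real_complex R)) (re_pairingZr _ Lmu Apsi) mulN1r.
Qed.

Lemma re_pairing_linl c mu nu phi : Linfty X mu -> Linfty X nu -> A2 X phi ->
  re_pairing (c%:C *: mu + nu) phi = c * re_pairing mu phi + re_pairing nu phi.
Proof.
move=> Lmu Lnu Aphi; have [M muM] := Linfty_bound Lmu; have [N nuN] := Linfty_bound Lnu.
have [smu _] := pairing_density Lmu Aphi muM.
have [snu _] := pairing_density Lnu Aphi nuN.
rewrite /re_pairing /= -(summable_density_lin c smu snu).2.
congr real_surface_integral; apply/funext => i; apply/funext => z.
by rewrite -[X in X * phi i z]/(c%:C * mu i z + nu i z) mulrDl raddfD /= -mulrA Re_real_mul.
Qed.

(** Ensures that mu belongs to its own coset, so that [xget] picks a genuine representative. *)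
Lemma Ninfty0 : Ninfty X 0.
Proof.
have z0 : real_surface_integral X (fun _ _ => 0) = 0 :> R.
  rewrite /real_surface_integral (_ : series _ = cst 0) ?lim_cst//.
  apply/funext => n /=; apply: big1 => i _.
  by rewrite (Rintegral_cst _ (measurable_piece X i)) mul0r.
split.
  split=> //.
  - by move=> i j z _ _; rewrite mul0r.
  - by exists 0 => i z; rewrite ComplexField.Normc.normc0.
move=> phi _; rewrite /int_pairing /surface_integral.
rewrite (_ : (fun i z => complex.Re _) = fun _ _ => 0) ?z0; last first.
  by apply/funext => i; apply/funext => z; rewrite mul0r.
rewrite (_ : (fun i z => complex.Im _) = fun _ _ => 0) ?z0//.
by apply/funext => i; apply/funext => z; rewrite mul0r.
Qed.

(** The representative chosen by [xget] differs from mu by an element of [Ninfty X], which pairs to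
    0 with phi. *)
Lemma pairing_tclass mu phi : Linfty X mu -> A2 X phi ->
  complex.Re (pairing X (tclass X mu) phi) = re_pairing mu phi.
Proof.
move=> Lmu Aphi.
have mu_mu : tclass X mu mu by split; rewrite ?subrr//; exact: Ninfty0.
have [Lnu [Ld Nd]] := xgetI 0 mu_mu; rewrite /pairing.
set nu := xget 0 (tclass X mu) in Lnu Ld Nd *.
rewrite -[LHS]/(re_pairing nu phi) -{1}(subrK mu nu) -[nu - mu]scale1r.
rewrite -(rmorph1 (real_complex R)) re_pairing_linl// mul1r.
by rewrite {1}/re_pairing Nd// add0r.
Qed.

(** For a positive norm, scale phi to the unit sphere over which the supremum is taken. For norm 0,
    the duality bound already shows that the pairing is at most 0. *)
Lemma re_pairing_le_metric mu phi : Linfty X mu -> A2 X phi ->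
  re_pairing mu phi <= teich_metric X (tclass X mu) * L1norm X phi.
Proof.
move=> Lmu Aphi; have [M muM] := Linfty_bound Lmu.
have := L1norm_ge0 Aphi; rewrite le_eqVlt => /predU1P[/esym n0|n0].
  have [_] := pairing_density Lmu Aphi muM.
  by rewrite n0 !mulr0 => /(le_trans (ler_norm _)).
have [Au nu] := A2Z (L1norm X phi)^-1 Aphi.
rewrite gtr0_norm ?invr_gt0// mulVf ?gt_eqF// in nu.
rewrite -ler_pdivrMr//; apply: ub_le_sup; last first.
  exists ((L1norm X phi)^-1%:C *: phi) => //.
  rewrite pairing_tclass//.
  by rewrite re_pairingZr// mulrC.
(* The bound M on mu keeps the supremum away from its default value. *)
exists M => _ [theta [Ath nth] <-]; rewrite pairing_tclass//.
have [_] := pairing_density Lmu Ath muM.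
by rewrite nth mulr1; exact: le_trans (ler_norm _).
Qed.

Lemma conjc_mul_normc (z : R[i]) : z^* * z = (normc z ^+ 2)%:C.
Proof.
case: z => a b /=; rewrite sqr_sqrtr ?addr_ge0 ?sqr_ge0//.
by apply/eqP; rewrite eq_complex /=; apply/andP; split; apply/eqP; ring.
Qed.

(** With T the derivative of a transition map, this turns the rule for quadratic differentials into
    the one for Beltrami forms: conj(T)^2 / |T|^2 = conj(T) / T. At T = 0 both sides are 0, because
    x / 0 = 0. *)
Lemma conj_div_norm_transition c (y T : R[i]) :
  (c / normc (y * T ^+ 2))%:C * (y * T ^+ 2)^* =
  (c / normc y)%:C * y^* * (T^* / T).
Proof.
have [->|T0] := eqVneq T 0; first by rewrite expr0n mulr0 invr0 !mulr0 raddf0 !mulr0.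
have n0 : normc T != 0.
  by apply/eqP => /ComplexField.Normc.eq0_normc; exact/eqP.
have TV : T^-1 = ((normc T)^-1 * (normc T)^-1)%:C * T^*.
  apply: (mulIf T0); rewrite mulVf// -mulrA conjc_mul_normc -rmorphM expr2.
  by rewrite mulrACA mulVf// mulr1 rmorph1.
have -> : (c / normc (y * T ^+ 2))%:C =
    (c / normc y)%:C * ((normc T)^-1 * (normc T)^-1)%:C.
  by rewrite -rmorphM expr2 !ComplexField.Normc.normcM !invfM; congr (_%:C); ring.
by rewrite TV expr2 !rmorphM; ring.
Qed.

(** The unit sphere contains both phi and - phi, so the supremum is at least a number and its
    opposite. *)
Lemma teich_metric_ge0 mu phi : Linfty X mu -> A2 X phi -> L1norm X phi = 1 ->
  0 <= teich_metric X (tclass X mu).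
Proof.
move=> Lmu Aphi phi1; have [Aphi' phi1'] := A2N Aphi.
have := re_pairing_le_metric Lmu Aphi; have := re_pairing_le_metric Lmu Aphi'.
rewrite -[in leLHS]scaleN1r -(rmorphN1 (real_complex R)) (re_pairingZr _ Lmu Aphi).
rewrite phi1' phi1 !mulr1 mulN1r lerNl => le1 le2.
by have := le_trans le1 le2; rewrite -subr_ge0 opprK -mulr2n pmulrn_lge0.
Qed.

(* This is c |eta| / eta, and 0 at the zeros of eta since x / 0 = 0. *)
Definition teich_beltrami c (eta : coeffs R) : coeffs R :=
  fun i z => (c / normc (eta i z))%:C * (eta i z)^*.

Lemma teich_beltrami_norm c eta i z : 0 <= c -> normc (teich_beltrami c eta i z) <= c.
Proof.
move=> c0; rewrite /teich_beltrami normc_real_mul.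
have -> : normc (eta i z)^* = normc (eta i z) by case: (eta i z) => a b /=; rewrite sqrrN.
rewrite ger0_norm ?divr_ge0 ?normc_ge0//.
have [->|n0] := eqVneq (normc (eta i z)) 0; first by rewrite mulr0.
by rewrite divfK.
Qed.

Lemma teich_beltrami_mul c eta i z :
  teich_beltrami c eta i z * eta i z = (c * normc (eta i z))%:C.
Proof.
rewrite /teich_beltrami -mulrA conjc_mul_normc -rmorphM/=; congr (_%:C).
have [->|n0] := eqVneq (normc (eta i z)) 0; first by rewrite expr0n !mulr0.
by rewrite expr2 mulrA divfK.
Qed.

Lemma teich_beltrami_Linfty c eta : 0 <= c -> A2 X eta -> Linfty X (teich_beltrami c eta).
Proof.
move=> c0 Aeta; have [zeta qeta _ _] := Aeta; split.
- by move=> i z iz; rewrite /teich_beltrami zeta// raddf0 mulr0.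
- move=> i j z iz jz; rewrite /teich_beltrami (qeta _ _ _ iz jz).
  exact: conj_div_norm_transition.
- move=> i; have [mr mi] := A2_measurable i Aeta; have mn := A2_measurable_normc i Aeta.
  have mV := measurable_fun_inv (fun w => normc_ge0 _) mn.
  have mc : measurable_fun [set: plane R] (fun w => c / normc (eta i (pt w))).
    exact: measurable_funM.
  split.
  + have := measurable_funM mc mr; congr measurable_fun; apply/funext => w /=.
    by rewrite /teich_beltrami Re_real_mul; case: (eta i _).
  + have := measurable_funM mc (measurable_funN mi); congr measurable_fun.
    by apply/funext => w /=; rewrite /teich_beltrami Im_real_mul; case: (eta i _).
- by exists c => i z; exact: teich_beltrami_norm.
Qed.

Lemma teich_beltrami_pairing c eta : 0 <= c -> A2 X eta ->
  re_pairing (teich_beltrami c eta) eta = c * L1norm X eta.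
Proof.
move=> c0 Aeta; have [seta eeta] := A2_density Aeta; rewrite eeta.
have := (summable_density_lin (c - 1) seta seta).2.
rewrite mulrBl mul1r subrK => <-; congr real_surface_integral.
apply/funext => i; apply/funext => z.
by rewrite teich_beltrami_mul /= mulrBl mul1r subrK.
Qed.

Lemma teich_beltrami_pairing_scale c eta phi : 0 <= c -> A2 X eta -> A2 X phi ->
  re_pairing (teich_beltrami c eta) phi = c * re_pairing (teich_beltrami 1 eta) phi.
Proof.
move=> c0 Aeta Aphi; have L1 := teich_beltrami_Linfty ler01 Aeta.
rewrite (_ : teich_beltrami c eta = (c - 1)%:C *: teich_beltrami 1 eta + teich_beltrami 1 eta).
  by rewrite re_pairing_linl// mulrBl mul1r subrK.
apply/funext => i; apply/funext => z.
rewrite -[RHS]/((c - 1)%:C * teich_beltrami 1 eta i z + teich_beltrami 1 eta i z).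
by rewrite /teich_beltrami mulrA -rmorphM -mulrDl -rmorphD; congr (_%:C * _); ring.
Qed.

(** The upper bound is the duality bound for a form of modulus at most c; the unit differential eta
    itself attains it. *)
Lemma teich_beltrami_metric c eta : 0 <= c -> A2 X eta -> L1norm X eta = 1 ->
  teich_metric X (tclass X (teich_beltrami c eta)) = c.
Proof.
move=> c0 Aeta n1; have Lmu := teich_beltrami_Linfty c0 Aeta.
apply/eqP; rewrite eq_le; apply/andP; split; last first.
  rewrite -[leLHS]mulr1 -[X in c * X]n1 -teich_beltrami_pairing// -[leRHS]mulr1 -n1.
  exact: re_pairing_le_metric.
apply: ge_sup; first by exists (complex.Re (pairing X (tclass X (teich_beltrami c eta)) eta)), eta.
move=> _ [theta [Ath nth] <-]; rewrite pairing_tclass//.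
have [_] := pairing_density Lmu Ath (fun i z => teich_beltrami_norm eta i z c0).
by rewrite nth mulr1; exact: le_trans (ler_norm _).
Qed.

End Pairing.

(** * The Randers cometric at a point *)

Unset Implicit Arguments.

Theorem theorem3p3 (R : realType) (g m : nat)
    (hg0 : g = 0%N -> (4 <= m)%N) (hg1 : g = 1%N -> (1 <= m)%N)
    (x : marked_surface R g m) (omega : one_form R g m) (psi : coeffs R)
    (hpsi : represented_by omega x psi)
    (hnorm : form_norm omega x = L1norm x psi) (hlt : L1norm x psi < 1)
    (phi : coeffs R) (hphi : A2 x phi) :
  randers_cometric omega x phi =
    inf [set t : R | 0 < t /\ L1norm x ((t^-1)%:C *: phi - psi) <= 1] /\
  (phi <> 0 ->
   L1norm x (((randers_cometric omega x phi)^-1)%:C *: phi - psi) = 1).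
Proof.
have [Apsi omegaE] := hpsi.
have randersE mu : Linfty x mu ->
    randers_metric omega x (tclass x mu) = teich_metric x (tclass x mu) + re_pairing x mu psi.
  move=> Lmu; rewrite /randers_metric omegaE; last by exists mu.
  by rewrite (pairing_tclass Lmu Apsi).
(* For phi = 0 every t > 0 is admissible, as |psi| < 1, so the infimum is 0. The supremum is over
   {0}, or over the empty set if no vector has Randers length 1; both give 0. *)
have [phi0|phi_neq0] := pselect (phi = 0).
  have pairing0 mu : Linfty x mu -> re_pairing x mu 0 = 0.
    move=> Lmu; rewrite -[RHS](mul0r (re_pairing x mu phi)) -(re_pairingZr _ Lmu hphi).
    by rewrite phi0 scaler0.
  have A0 : A2 x 0 by rewrite -phi0.
  split; last by move=> /(_ phi0).
  rewrite phi0.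
  have -> : [set t : R | 0 < t /\ L1norm x (t^-1%:C *: (0 : coeffs R) - psi) <= 1] =
      `]0, +oo[%classic.
    apply/seteqP; split=> t /=; rewrite in_itv /= andbT; first by case.
    by move=> t0; split; rewrite ?scaler0 ?add0r ?(A2N Apsi).2 ?(ltW hlt).
  rewrite inf_itv// /randers_cometric.
  have [[v0 Sv0]|nS] := pselect ([set v | tangent x v /\ randers_metric omega x v = 1] !=set0).
    rewrite (_ : [set _ | _ in _] = [set 0]) ?sup1//; apply/seteqP.
    split=> [_ [v [[mu Lmu <-] _] <-]|_ ->].
      by rewrite (pairing_tclass Lmu A0) (pairing0 _ Lmu).
    exists v0 => //; case: Sv0 => [[mu Lmu <-] _].
    by rewrite (pairing_tclass Lmu A0) (pairing0 _ Lmu).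
  rewrite (_ : [set _ | _ in _] = set0) ?sup0//; apply/seteqP; split=> [r [v Sv _]|//].
  by apply: nS; exists v.
have [S S0 NS] := L1norm_crossing hphi Apsi phi_neq0 hlt.
pose eta := S%:C *: phi - psi.
have Aeta : A2 x eta by exact: A2B.
have eta1 : L1norm x eta = 1 by exact: NS.
have upper t v : 0 < t -> L1norm x (t^-1%:C *: phi - psi) <= 1 -> tangent x v ->
    randers_metric omega x v = 1 -> complex.Re (pairing x v phi) <= t.
  move=> t0 nt [mu Lmu <-]; rewrite (randersE _ Lmu) (pairing_tclass Lmu hphi).
  (* A nonnegative kappa lets the bound |phi/t - psi| <= 1 be multiplied by it, so that Re<mu, phi/t
     - psi> <= kappa. *)
  have kappa0 := teich_metric_ge0 Lmu Aeta eta1.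
  have := re_pairing_le_metric Lmu (A2B t^-1 hphi Apsi).
  rewrite (re_pairing_subr _ Lmu hphi Apsi) => le_t; move: (ler_wpM2l kappa0 nt); rewrite mulr1.
  move=> /(le_trans le_t) {}le_t k1.
  rewrite -[leRHS]mulr1 -(ler_pdivrMl _ _ t0).
  by move: le_t; rewrite lerBlDr k1.
have L1 := teich_beltrami_Linfty ler01 Aeta.
(* This is the Randers length of the class of |eta|/eta; it is at least 1 - |psi| > 0, and dividing
   by it yields a vector of length 1. *)
pose k := 1 + re_pairing x (teich_beltrami 1 eta) psi.
have k0 : 0 < k.
  have [_] := pairing_density L1 Apsi (fun i z => teich_beltrami_norm eta i z ler01).
  rewrite mul1r ler_norml => /andP[le1 _].
  by rewrite /k -ltrBlDl sub0r (lt_le_trans _ le1)// ltrN2.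
have kV0 : 0 <= k^-1 by rewrite invr_ge0 ltW.
pose mu := teich_beltrami k^-1 eta.
have Lmu : Linfty x mu by exact: (teich_beltrami_Linfty kV0 Aeta).
have mu_psi : re_pairing x mu psi = 1 - k^-1.
  rewrite (teich_beltrami_pairing_scale kV0 Aeta Apsi).
  have -> : re_pairing x (teich_beltrami 1 eta) psi = k - 1 by rewrite /k [1 + _]addrC addrK.
  by rewrite mulrBr mulr1 (mulVf (lt0r_neq0 k0)).
have mu_randers : randers_metric omega x (tclass x mu) = 1.
  by rewrite (randersE _ Lmu) (teich_beltrami_metric kV0 Aeta eta1) mu_psi addrC subrK.
(* Expanding Re<mu, eta> = 1/k with eta = S phi - psi gives S Re<mu, phi> = 1/k + (1 - 1/k) = 1. *)
have mu_phi : complex.Re (pairing x (tclass x mu) phi) = S^-1.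
  rewrite (pairing_tclass Lmu hphi).
  have := teich_beltrami_pairing kV0 Aeta.
  rewrite eta1 mulr1 (re_pairing_subr _ Lmu hphi Apsi) mu_psi => e1.
  apply: (mulfI (lt0r_neq0 S0)); rewrite divff ?gt_eqF//.
  by move/eqP: e1; rewrite subr_eq addrC subrK => /eqP.
have tmu : tangent x (tclass x mu) by exists mu.
have GE : randers_cometric omega x phi = S^-1.
  apply/eqP; rewrite eq_le; apply/andP; split.
    apply: ge_sup; first by exists (complex.Re (pairing x (tclass x mu) phi)), (tclass x mu).
    move=> _ [v [tv v1] <-]; apply: (upper _ v) => //; first by rewrite invr_gt0.
    by rewrite invrK NS.
  apply: ub_le_sup; last by exists (tclass x mu).
  exists S^-1 => _ [v [tv v1] <-]; apply: (upper _ v) => //; first by rewrite invr_gt0.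
  by rewrite invrK NS.
rewrite GE invrK; split; last by [].
(* Each admissible t is at least Re<mu, phi> = 1/S, by [upper] applied to the extremal vector, and
   1/S is itself admissible. *)
apply/eqP; rewrite eq_le; apply/andP; split.
  apply: lb_le_inf.
    by exists S^-1; split; [rewrite invr_gt0|rewrite invrK NS].
  by move=> t [t0 nt]; rewrite -mu_phi; exact: upper.
apply: ge_inf; first by exists 0 => t [/ltW].
by split; [rewrite invr_gt0|rewrite invrK NS].
Qed.
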